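(* Let $n\geq1$ be an integer and $p\geq1$ a real number. Let $\nu\in\mathcal{W}_p(\mathbb{H}^n)$ and define $\mu=\pi_{\#}\nu$, where $\pi:\mathbb{H}^n\to\mathbb{R}^{2n}$, $\pi(x,y,z)=(x,y)$. Then $\mu\in\mathcal{W}_p(\mathbb{R}^{2n})$. Moreover, assume that the mapping $T:\mathbb{R}^{2n}\to\mathbb{R}^{2n}$, $T(x,y)=(T_1(x,y),T_2(x,y))$ with $T_1(x,y),T_2(x,y)\in\mathbb{R}^n$ for $(x,y)\in\mathbb{R}^{n}\times\mathbb{R}^n$, is an optimal transport map between $\mu$ and $T_{\#}\mu$. Then the lifted mapping $\widehat{T}:\mathbb{H}^n\to\mathbb{H}^n$ defined by $$\widehat{T}(x,y,z)=\big(T_1(x,y),\,T_2(x,y),\,z+2(y\cdot T_1(x,y)-x\cdot T_2(x,y))\big),\qquad (x,y,z)\in\mathbb{H}^n,$$ is an optimal transport map between $\nu$ and $\widehat{T}_{\#}\nu$.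
   Context: Heisenberg group: $\mathbb{H}^n=\mathbb{R}^n\times\mathbb{R}^n\times\mathbb{R}$ with the group operation $(x,y,z)\ast(x',y',z')=\big(x+x',\,y+y',\,z+z'+2\sum_{i=1}^n(x'_iy_i-x_iy'_i)\big)$. It is endowed with the left-invariant Heisenberg-Korányi metric $d_H((x,y,z),(x',y',z'))=\|(-x,-y,-z)\ast(x',y',z')\|_H$, where $\|(x,y,z)\|_H=\Big(\big(\sum_{i=1}^n(x_i^2+y_i^2)\big)^2+z^2\Big)^{1/4}$. The space $\mathbb{R}^{2n}$ carries the Euclidean distance, and $x\cdot y$ denotes the standard scalar product on $\mathbb{R}^n$. Wasserstein space: for a complete separable metric space $(X,\varrho)$ and $p\geq1$, $\mathcal{W}_p(X)$ is the set of Borel probability measures $\mu$ on $X$ with $\int_X\varrho^p(x,\hat x)\,\mathrm{d}\mu(x)<\infty$ for some (hence all) $\hat x\in X$, endowed with the distance $d_{\mathcal{W}_p}(\mu,\nu)=\Big(\inf_{\Pi\in C(\mu,\nu)}\iint_{X\times X}\varrho^p(x,y)\,\mathrm{d}\Pi(x,y)\Big)^{1/p}$, where $C(\mu,\nu)$ is the set of couplings, i.e. Borel probability measures on $X\times X$ with marginals $\mu$ and $\nu$. A coupling attaining the infimum is called optimal. Push-forward: $(f_{\#}\mu)(A)=\mu(f^{-1}[A])$ for Borel sets $A$. Optimal transport map: for $\mu\in\mathcal{W}_p(X)$, a Borel map $T:X\to X$ with $T_{\#}\mu\in\mathcal{W}_p(X)$ is an optimal transport map between $\mu$ and $T_{\#}\mu$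 if the coupling $(\mathrm{Id}\times T)_{\#}\mu$, with $(\mathrm{Id}\times T)(q)=(q,T(q))$, is optimal; equivalently $d_{\mathcal{W}_p}^p(\mu,T_{\#}\mu)=\int_X\varrho^p(q,T(q))\,\mathrm{d}\mu(q)$. *)

(* Defs.v *)
From HB Require Import structures.
From mathcomp Require Import all_boot all_order all_algebra.
From mathcomp Require Import all_classical all_reals all_analysis.
From mathcomp Require Import ring lra.

Set Implicit Arguments.
Unset Strict Implicit.
Unset Printing Implicit Defensive.

Import Order.TTheory GRing.Theory Num.Theory.
Import numFieldNormedType.Exports.

Local Open Scope classical_set_scope.
Local Open Scope ring_scope.

(* [Pointed] is what the measure theory of the library asks of a carrier. *)
#[short(type="pMetricType")]
HB.structure Definition PointedMetric (K : numDomainType) :=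
  {M of Metric K M & Pointed M}.

Notation borel X := (g_sigma_algebraType (@open X)).

Lemma continuous_borel (X Y : ptopologicalType) (f : X -> Y) :
  continuous f -> measurable_fun [set: borel X] (f : borel X -> borel Y).
Proof.
move=> /continuousP cf; apply: (@measurability _ _ (borel X) (borel Y) setT f (@open Y)) => //.
by move=> _ [B oB <-]; rewrite setTI; apply: sub_gen_smallest; exact: cf.
Qed.

Definition pushforward_prob d d' (S : measurableType d) (T : measurableType d')
    (R : realType) (mu : probability S R) (f : S -> T)
    (mf : measurable_fun [set: S] f) : probability T R :=
  distribution mu (mfun_Sub (mem_set mf)).

Section wasserstein.
Context {R : realType} {X : pMetricType R}.
Local Open Scope ereal_scope.

Definition wasserstein_space (p : R) : set (probability (borel X) R) :=
  [set mu : probability (borel X) R |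
     exists x0 : X, \int[mu]_x (mdist (x : X) x0 `^ p)%:E < +oo].

(* The Borel sets of [X * X] are those of the product topology. *)
Definition couplings (mu nu : probability (borel X) R) :
    set (probability (borel (X * X)%type) R) :=
  [set Pi | forall A : set (borel X), measurable A ->
     Pi (fst @^-1` A) = mu A /\ Pi (snd @^-1` A) = nu A].

Definition transport_cost (p : R) (Pi : probability (borel (X * X)%type) R) :
    \bar R :=
  \int[Pi]_q (mdist (q.1 : X) (q.2 : X) `^ p)%:E.

Definition optimal_coupling (p : R) (mu nu : probability (borel X) R)
    (Pi : probability (borel (X * X)%type) R) : Prop :=
  couplings mu nu Pi /\
  transport_cost p Pi = ereal_inf (transport_cost p @` couplings mu nu).

(* [mIdT] ensures that the push-forward of [mu] along [Id x T] is defined on   *)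
(* the Borel sets of [X * X]; it follows from [mT] when [X] is separable.      *)
Definition optimal_transport_map (p : R) (mu : probability (borel X) R)
    (T : X -> X) : Prop :=
  exists (mT : measurable_fun [set: borel X] (T : borel X -> borel X))
    (mIdT : measurable_fun [set: borel X]
       ((fun q => (q, T q)) : borel X -> borel (X * X)%type)),
    wasserstein_space p (pushforward_prob mu mT) /\
    optimal_coupling p mu (pushforward_prob mu mT) (pushforward_prob mu mIdT).

End wasserstein.

Definition dotv (R : realType) (n : nat) (u v : 'rV[R]_n) : R :=
  \sum_(i < n) u 0 i * v 0 i.

Definition euclid (R : realType) (n : nat) : Type := ('rV[R]_n * 'rV[R]_n)%type.

Definition heis (R : realType) (n : nat) : Type :=
  ('rV[R]_n * 'rV[R]_n * R)%type.

Section spaces.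
Context {R : realType} {n : nat}.
Implicit Types (u v : euclid R n) (q : heis R n).

Definition euclid_dist u v : R :=
  Num.sqrt (\sum_(i < n) ((u.1 0 i - v.1 0 i) ^+ 2 + (u.2 0 i - v.2 0 i) ^+ 2)).

Definition heis_mul q q' : heis R n :=
  let: (x, y, z) := q in let: (x', y', z') := q' in
  (x + x', y + y',
   z + z' + 2 * \sum_(i < n) (x' 0 i * y 0 i - x 0 i * y' 0 i)).

Definition heis_opp q : heis R n := let: (x, y, z) := q in (- x, - y, - z).

Definition koranyi_norm q : R :=
  let: (x, y, z) := q in
  ((\sum_(i < n) (x 0 i ^+ 2 + y 0 i ^+ 2)) ^+ 2 + z ^+ 2) `^ 4^-1.

Definition heis_dist q q' : R := koranyi_norm (heis_mul (heis_opp q) q').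

Definition heis_proj q : euclid R n := q.1.

Definition heis_lift (T : euclid R n -> euclid R n) q : heis R n :=
  let: (x, y, z) := q in
  let T1 := (T (x, y)).1 in let T2 := (T (x, y)).2 in
  (T1, T2, z + 2 * (dotv y T1 - dotv x T2)).

End spaces.

Section metric_proofs.
Context {R : realType} {n : nat}.
Implicit Types (u v w : euclid R n) (q : heis R n).

Let edot u v : R := \sum_(i < n) (u.1 0 i * v.1 0 i + u.2 0 i * v.2 0 i).
Let comb (a : R) u (b : R) v : euclid R n :=
  (a *: u.1 + b *: v.1, a *: u.2 + b *: v.2).
(* Multiplication by the imaginary unit under [(x, y) |-> x + i y]: the bound  *)
(* [edot_hCS] is the Hermitian Cauchy-Schwarz inequality, on which the         *)
(* triangle inequality for the Koranyi norm rests.                             *)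
Let rot u : euclid R n := (- u.2, u.1).

Let edot_ge0 u : 0 <= edot u u.
Proof. by apply: sumr_ge0 => i _; rewrite addr_ge0// -expr2 sqr_ge0. Qed.

Let edotC u v : edot u v = edot v u.
Proof. by apply: eq_bigr => i _; ring. Qed.

Let edot_combr w a u b v :
  edot w (comb a u b v) = a * edot w u + b * edot w v.
Proof.
by rewrite !mulr_sumr -big_split/=; apply: eq_bigr => i _; rewrite !mxE; ring.
Qed.

Let edot_comb a u b v : edot (comb a u b v) (comb a u b v) =
  a ^+ 2 * edot u u + 2 * a * b * edot u v + b ^+ 2 * edot v v.
Proof.
by rewrite edot_combr edotC edot_combr (edotC (comb _ _ _ _) v) edot_combr
  (edotC v u); ring.
Qed.

Let edot_eq0 u : edot u u = 0 -> u = (0, 0).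
Proof.
move=> u0; have h i : u.1 0 i = 0 /\ u.2 0 i = 0.
  have /eqP := u0; rewrite psumr_eq0; last first.
    by move=> j _; rewrite addr_ge0// -expr2 sqr_ge0.
  move=> /allP/(_ i); rewrite mem_index_enum => /(_ isT)/=.
  rewrite paddr_eq0 -?expr2 ?sqr_ge0// !sqrf_eq0.
  by move=> /andP[/eqP -> /eqP ->].
case: u u0 h => u1 u2 _ /= h.
by congr pair; apply/rowP => i; rewrite mxE; case: (h i).
Qed.

Let edot_CS u v : edot u v ^+ 2 <= edot u u * edot v v.
Proof.
have [v0|v0] := eqVneq (edot v v) 0.
  rewrite (_ : edot u v = 0) ?expr0n/= ?mulr_ge0//.
  by rewrite (edot_eq0 v0) /edot big1// => i _; rewrite !mxE; ring.
have vp : 0 < edot v v by rewrite lt_neqAle eq_sym v0 edot_ge0.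
have := edot_ge0 (comb (edot v v) u (- edot u v) v).
rewrite edot_comb (_ : _ + _ = edot v v * (edot u u * edot v v - edot u v ^+ 2)).
  by rewrite pmulr_rge0// subr_ge0.
by ring.
Qed.

Let edot_hCS u v : edot u v ^+ 2 + edot u (rot v) ^+ 2 <= edot u u * edot v v.
Proof.
set s := _ + _.
have s0 : 0 <= s by rewrite addr_ge0// sqr_ge0.
have [->|sn0] := eqVneq s 0; first by rewrite mulr_ge0.
have := edot_CS u (comb (edot u v) v (edot u (rot v)) (rot v)).
rewrite edot_comb edot_combr.
have -> : edot v (rot v) = 0.
  by rewrite /edot big1// => i _; rewrite !mxE; ring.
have -> : edot (rot v) (rot v) = edot v v.
  by apply: eq_bigr => i _; rewrite !mxE; ring.
rewrite -!expr2 -/s mulr0 addr0 -mulrDl -/s mulrCA expr2 ler_pM2l//.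
by rewrite lt_neqAle eq_sym sn0.
Qed.

Let sqrt_edotD u v :
  Num.sqrt (edot (comb 1 u 1 v) (comb 1 u 1 v)) <=
  Num.sqrt (edot u u) + Num.sqrt (edot v v).
Proof.
rewrite -(@ler_pXn2r _ 2) ?nnegrE ?addr_ge0 ?sqrtr_ge0// sqrrD !sqr_sqrtr//.
rewrite edot_comb !expr1n !mul1r !mulr1 lerD2r lerD2l mulr_natl lerMn2r/=.
rewrite (le_trans (ler_norm _))// -sqrtrM// -sqrtr_sqr ler_wsqrtr // edot_CS.
Qed.

Let euclid_distE u v :
  euclid_dist u v = Num.sqrt (edot (comb 1 u (-1) v) (comb 1 u (-1) v)).
Proof. by congr Num.sqrt; apply: eq_bigr => i _; rewrite !mxE; ring. Qed.

Fact euclid_distxx u : euclid_dist u u = 0.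
Proof.
by rewrite /euclid_dist big1 ?sqrtr0// => i _; rewrite !subrr expr0n/= addr0.
Qed.

Fact euclid_dist_positivity u v : euclid_dist u v = 0 -> u = v.
Proof.
rewrite euclid_distE => /eqP; rewrite sqrtr_eq0 => h.
have /edot_eq0 : edot (comb 1 u (-1) v) (comb 1 u (-1) v) = 0.
  by apply/eqP; rewrite eq_le h edot_ge0.
case: u v {h} => [u1 u2] [v1 v2] [/=].
by rewrite !scale1r !scaleN1r => /subr0_eq -> /subr0_eq ->.
Qed.

Fact euclid_dist_sym u v : euclid_dist u v = euclid_dist v u.
Proof. by congr Num.sqrt; apply: eq_bigr => i _; ring. Qed.

Fact euclid_dist_triangle v u w :
  euclid_dist u w <= euclid_dist u v + euclid_dist v w.
Proof.
rewrite !euclid_distE; apply: le_trans (sqrt_edotD _ _).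
rewrite le_eqVlt; apply/orP; left; apply/eqP; congr Num.sqrt.
by apply: eq_bigr => i _; rewrite !mxE; ring.
Qed.

Let hnorm (a z : R) : R := Num.sqrt (a ^+ 2 + z ^+ 2).

Let hnormD a z a' z' : hnorm (a + a') (z + z') <= hnorm a z + hnorm a' z'.
Proof.
rewrite -(@ler_pXn2r _ 2) ?nnegrE ?addr_ge0 ?sqrtr_ge0// sqrrD.
rewrite !sqr_sqrtr ?addr_ge0 ?sqr_ge0//.
suff : a * a' + z * z' <= hnorm a z * hnorm a' z' by rewrite /hnorm; lra.
rewrite -sqrtrM ?addr_ge0 ?sqr_ge0// (le_trans (ler_norm _))// -sqrtr_sqr.
rewrite ler_wsqrtr// -subr_ge0 (_ : _ - _ = (a * z' - a' * z) ^+ 2) ?sqr_ge0//.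
by ring.
Qed.

Let koranyiE q : koranyi_norm q = Num.sqrt (hnorm (edot q.1 q.1) q.2).
Proof.
case: q => [[x y] z]; rewrite /koranyi_norm /hnorm.
rewrite (_ : 4^-1 = 2^-1 * 2^-1 :> R); last by rewrite -invfM -natrM.
by rewrite powRrM !powR12_sqrt// ?sqrtr_ge0 ?addr_ge0 ?sqr_ge0//.
Qed.

Fact koranyi_norm_ge0 q : 0 <= koranyi_norm q.
Proof. by rewrite koranyiE sqrtr_ge0. Qed.

Fact koranyi_norm0 : koranyi_norm (0 : 'rV[R]_n, 0 : 'rV[R]_n, 0 : R) = 0.
Proof.
rewrite koranyiE /edot big1/=; last by move=> i _; rewrite !mxE; ring.
by rewrite /hnorm expr0n/= addr0 !sqrtr0.
Qed.

Fact koranyi_norm_eq0 q : koranyi_norm q = 0 -> q = (0, 0, 0).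
Proof.
rewrite koranyiE => /eqP; rewrite sqrtr_eq0 => h.
have : hnorm (edot q.1 q.1) q.2 = 0 by apply/eqP; rewrite eq_le h sqrtr_ge0.
move=> /eqP; rewrite sqrtr_eq0 => {}h.
have : (edot q.1 q.1) ^+ 2 + q.2 ^+ 2 == 0.
  by rewrite eq_le h addr_ge0// sqr_ge0.
rewrite paddr_eq0 ?sqr_ge0// !sqrf_eq0 => /andP[/eqP/edot_eq0 + /eqP].
by case: q {h} => [[x y] z]/= -> ->.
Qed.

Fact koranyi_normN q : koranyi_norm (heis_opp q) = koranyi_norm q.
Proof.
case: q => [[x y] z]; rewrite /koranyi_norm /= sqrrN.
by congr (_ `^ _); congr (_ ^+ 2 + _); apply: eq_bigr => i _; rewrite !mxE; ring.
Qed.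

Fact koranyi_norm_triangle q q' :
  koranyi_norm (heis_mul q q') <= koranyi_norm q + koranyi_norm q'.
Proof.
rewrite -(@ler_pXn2r _ 2) ?nnegrE ?addr_ge0 ?koranyi_norm_ge0//.
rewrite sqrrD !koranyiE !sqr_sqrtr ?sqrtr_ge0//.
case: q q' => [u z] [u' z'].
have -> : heis_mul (u, z) (u', z') =
    (comb 1 u 1 u', z + z' + 2 * edot u (rot u')).
  case: u u' => [x y] [x' y']; rewrite /comb/= !scale1r.
  congr (_, _ + 2 * _); apply: eq_bigr => i _; rewrite !mxE; ring.
rewrite [(_, _).1]/= [(_, _).2]/= edot_comb !expr1n !mul1r !mulr1.
rewrite -[X in X + _ + _]addr0 -addrA.
have -> : edot u u + 0 + (2 * edot u u' + edot u' u') =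
  edot u u + edot u' u' + 2 * edot u u' by ring.
apply: le_trans (hnormD _ _ _ _) _.
have h1 := hnormD (edot u u) z (edot u' u') z'.
have h2 : hnorm (2 * edot u u') (2 * edot u (rot u')) <=
    2 * (Num.sqrt (edot u u) * Num.sqrt (edot u' u')).
  rewrite /hnorm !exprMn -mulrDr sqrtrM ?sqr_ge0// sqrtr_sqr.
  by rewrite ger0_norm// ler_wpM2l// -sqrtrM// ler_wsqrtr// edot_hCS.
have h3 v t : Num.sqrt (edot v v) <= Num.sqrt (hnorm (edot v v) t).
  rewrite ler_wsqrtr// -[leLHS]ger0_norm// -sqrtr_sqr ler_wsqrtr//.
  by rewrite lerDl sqr_ge0.
have h4 : Num.sqrt (edot u u) * Num.sqrt (edot u' u') <=
    Num.sqrt (hnorm (edot u u) z) * Num.sqrt (hnorm (edot u' u') z').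
  by apply: ler_pM; rewrite ?sqrtr_ge0.
by move: h1 h2 h4 => /=; lra.
Qed.

Let heis_eq (x x' y y' : 'rV[R]_n) (z z' : R) :
  x = x' -> y = y' -> z = z' -> (x, y, z) = (x', y', z').
Proof. by move=> -> -> ->. Qed.

Fact heis_mulNq q : heis_mul (heis_opp q) q = (0, 0, 0).
Proof.
case: q => [[x y] z]; apply: heis_eq; rewrite ?addNr//.
by rewrite big1 ?mulr0 ?addr0// => i _; rewrite !mxE; ring.
Qed.

Fact heis_distxx q : heis_dist q q = 0.
Proof. by rewrite /heis_dist heis_mulNq koranyi_norm0. Qed.

Fact heis_dist_positivity q q' : heis_dist q q' = 0 -> q = q'.
Proof.
move=> /koranyi_norm_eq0; case: q q' => [[x y] z] [[x' y'] z'] [].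
move=> /eqP; rewrite addrC subr_eq0 => /eqP ->.
move=> /eqP; rewrite addrC subr_eq0 => /eqP ->.
rewrite big1 ?mulr0 ?addr0; last by move=> i _; rewrite !mxE; ring.
by move=> /eqP; rewrite addrC subr_eq0 => /eqP ->.
Qed.

Fact heis_dist_sym q q' : heis_dist q q' = heis_dist q' q.
Proof.
rewrite /heis_dist -koranyi_normN; congr koranyi_norm.
case: q q' => [[x y] z] [[x' y'] z']; apply: heis_eq.
- by rewrite opprD opprK addrC.
- by rewrite opprD opprK addrC.
- rewrite !opprD opprK -mulrN -sumrN (addrC z); congr (_ + 2 * _).
  by apply: eq_bigr => i _; rewrite !mxE; ring.
Qed.

Fact heis_dist_triangle q' q q'' :
  heis_dist q q'' <= heis_dist q q' + heis_dist q' q''.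
Proof.
apply: le_trans (koranyi_norm_triangle _ _); rewrite le_eqVlt; apply/orP; left.
apply/eqP; congr koranyi_norm.
case: q q' q'' => [[x y] z] [[x' y'] z'] [[x'' y''] z'']; apply: heis_eq.
- by rewrite addrA addrK.
- by rewrite addrA addrK.
- set s := \sum_i _; set s1 := \sum_i _; set s2 := \sum_i _; set s3 := \sum_i _.
  have -> : s = s1 + s2 + s3.
    rewrite /s /s1 /s2 /s3 -!big_split/=.
    by apply: eq_bigr => i _; rewrite !mxE; ring.
  by ring.
Qed.

Fact euclid_dist_proj q q' :
  euclid_dist (heis_proj q) (heis_proj q') <= heis_dist q q'.
Proof.
rewrite /heis_dist koranyiE /hnorm ler_wsqrtr//.
set e := edot _ _; rewrite (_ : \sum_(i < n) _ = e); last first.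
  case: q q' @e => [[x y] z] [[x' y'] z'] /=.
  by apply: eq_bigr => i _; rewrite !mxE; ring.
rewrite -[leLHS]ger0_norm ?edot_ge0// -sqrtr_sqr ler_wsqrtr//.
by rewrite lerDl sqr_ge0.
Qed.

End metric_proofs.

HB.instance Definition _ (R : realType) (n : nat) :=
  Pointed.copy (euclid R n) ('rV[R]_n * 'rV[R]_n)%type.
HB.instance Definition _ (R : realType) (n : nat) :=
  isMetric.Build R (euclid R n) euclid_distxx euclid_dist_positivity
    euclid_dist_sym euclid_dist_triangle.

HB.instance Definition _ (R : realType) (n : nat) :=
  Pointed.copy (heis R n) ('rV[R]_n * 'rV[R]_n * R)%type.
HB.instance Definition _ (R : realType) (n : nat) :=
  isMetric.Build R (heis R n) heis_distxx heis_dist_positivity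
    heis_dist_sym heis_dist_triangle.

Fact euclid_mdistE (R : realType) (n : nat) (u v : euclid R n) :
  mdist u v = euclid_dist u v.
Proof. by []. Qed.

Fact heis_mdistE (R : realType) (n : nat) (q q' : heis R n) :
  mdist q q' = heis_dist q q'.
Proof. by []. Qed.

Lemma continuous_heis_proj (R : realType) (n : nat) :
  continuous (@heis_proj R n).
Proof.
move=> q; apply/(@metricType_numDomainType.cvgrPdist_lt _ _ _ _
  (nbhs_filter q)) => e e0.
change (nbhs q [set q' | euclid_dist (heis_proj q) (heis_proj q') < e]).
rewrite -metricType_numDomainType.filter_from_mdist_nbhs.
exists e => //= q' qq'.
exact: le_lt_trans (euclid_dist_proj q q') qq'.
Qed.

Lemma measurable_heis_proj (R : realType) (n : nat) :
  measurable_fun [set: borel (heis R n)]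
    (@heis_proj R n : borel (heis R n) -> borel (euclid R n)).
Proof. by apply: continuous_borel; exact: continuous_heis_proj. Qed.

(* Main.v *)
Require Import Defs.
From HB Require Import structures.
From mathcomp Require Import all_boot all_order all_algebra.
From mathcomp Require Import all_classical all_reals all_analysis.
From mathcomp Require Import measurable_realfun ring lra.

Set Implicit Arguments.
Unset Strict Implicit.
Unset Printing Implicit Defensive.

Import Order.TTheory GRing.Theory Num.Theory.
Import numFieldNormedType.Exports.

Local Open Scope classical_set_scope.
Local Open Scope ring_scope.

(** The projection [heis_proj] is 1-Lipschitz, and the height
    [z + 2 (y . T1 - x . T2)] in the definition of the lift is the one that
    cancels the vertical coordinate of [(-q) * heis_lift T q].  Hence moving [q]
    to [heis_lift T q] costs exactly what moving [heis_proj q] to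
    [T (heis_proj q)] costs ([heis_dist_lift]): the lift moves points along
    horizontal lines, on which the projection is an isometry.

    Optimality follows by comparing infima.  Any coupling of [nu] with the image
    of [nu] under the lift projects to a coupling of [mu] with the image of [mu]
    under [T], because [heis_proj] intertwines the lift with [T], and projecting
    does not increase the cost.  So the infimum upstairs is at least the infimum
    downstairs, which is the cost of [T], which is the cost of the lift.  This
    argument uses only the short map, the intertwining and the equality of
    displacements, and is carried out for arbitrary metric spaces in
    [optimal_transport_map_lift].

    The image of [nu] under the lift has a finite [p]-th moment because, for
    [nu] in the Wasserstein space, this amounts to finiteness of the cost of the
    map ([wasserstein_space_pushforward]), and the two costs agree.

    What remains is Borel measurability of the lift and of its graph map.  The
    topology of the Heisenberg group is that of the Koranyi distance, so this is
    not a statement about a product of Borel spaces.  In a separable metric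
    space a map [f] is Borel as soon as every distance function
    [s |-> mdist x (f s)] is ([measurable_borel_mdist], and
    [measurable_borel_pair] for pairs); for the Heisenberg group, the rational
    points are dense ([dense_rat_heis]), and the distance to a fixed point is an
    explicit function of the coordinates, which are themselves Borel. *)

(** * Measurability into separable metric spaces *)

(** Lets the Borel sets of [X * X] fall under the lemmas stated for pointed
    topological or pseudometric spaces. *)
HB.instance Definition _ (R : realType) (X Y : pseudoPMetricType R) :=
  Pointed.on (X * Y)%type.

Definition ball_dense (R : realType) (X : pseudoMetricType R) (I : Type)
    (D : I -> X) :=
  forall x (e : R), 0 < e -> exists i, ball x e (D i).

Lemma open_bigcup_dense_ball (R : realType) (X : pseudoMetricType R) (I : Type)
    (D : I -> X) (U : set X) :
    ball_dense D -> open U ->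
  U = \bigcup_(j in [set j : I * rat | ball (D j.1) (ratr j.2) `<=` U])
        ball (D j.1) (ratr j.2).
Proof.
move=> denseD oU; apply/seteqP; split => [x Ux|x [j /= jU]]; last exact: jU.
have /nbhs_ballP[e /= e0 xeU] := open_nbhs_nbhs (conj oU Ux).
have e20 : 0 < e / 2 by rewrite divr_gt0.
have [r] := rat_in_itvoo e20; rewrite in_itv/= => /andP[r0 re].
have [i xDi] := denseD x _ r0.
exists (i, r) => /=; last exact: ball_sym.
move=> y Diy; apply: xeU; apply: (@le_ball _ _ _ (ratr r + ratr r)).
  by rewrite (splitr e) lerD// ltW.
exact: ball_triangle xDi Diy.
Qed.

(** Every open set is a countable union of balls with rational radii centred on
    the family.  The balls of a pseudometric space need not be open, so their
    preimages are what the hypothesis is about; the product of two spaces is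
    covered as well, its balls being products of balls. *)
Lemma measurable_borel_ball d (S : measurableType d) (R : realType)
    (X : pseudoPMetricType R) (I : countType) (D : I -> X) (f : S -> X) :
    ball_dense D ->
    (forall i (e : R), measurable (f @^-1` ball (D i) e)) ->
  measurable_fun [set: S] (f : S -> borel X).
Proof.
move=> denseD mf.
apply: (@measurability _ _ S (borel X) setT f (@open X)) => //.
move=> _ [U oU <-]; rewrite setTI (open_bigcup_dense_ball denseD oU).
rewrite preimage_bigcup bigcup_mkcond.
apply: (countable_bigcupT_measurable (countableP _)) => -[i r].
by case: ifP.
Qed.

Lemma continuous_borel_real (R : realType) (X : ptopologicalType) (f : X -> R) :
  continuous f -> measurable_fun [set: borel X] (f : borel X -> R).
Proof.
move=> /continuousP cf; apply: (measurability _ (RGenOpens.measurableE R)).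
move=> _ [_ [a [b ->] <-]]; rewrite setTI; apply: sub_gen_smallest.
exact/cf/interval_open.
Qed.

Lemma continuous_mdist (R : realType) (X : metricType R) :
  continuous (fun q : X * X => mdist q.1 q.2).
Proof.
move=> [x y]; apply/cvgrPdist_lt => /= e e0.
have e20 : 0 < e / 2 by rewrite divr_gt0.
near=> q.
have : mdist x q.1 < e / 2 /\ mdist y q.2 < e / 2.
  near: q.
  have := nbhsx_ballx (x, y) _ e20; apply: filterS => q'.
  by case: q' => x' y' [/=]; rewrite !ballEmdist.
move=> [xq yq].
have := metric_triangle x q.1 y; have := metric_triangle q.1 q.2 y.
have := metric_triangle q.1 x q.2; have := metric_triangle x y q.2.
rewrite (metric_sym q.1 x) (metric_sym q.2 y) ltr_norml => *.
by apply/andP; split; lra.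
Unshelve. all: by end_near. Qed.

Lemma lipschitz1_continuous (R : realType) (X : metricType R) (f : X -> R) :
  (forall x y, `|f x - f y| <= mdist x y) -> continuous f.
Proof.
move=> fl x; apply/cvgrPdist_lt => /= e e0; near=> y.
apply: le_lt_trans (fl x y) _; near: y.
by have := nbhsx_ballx x _ e0; rewrite ballEmdist.
Unshelve. all: by end_near. Qed.

Lemma measurable_mdist (R : realType) (X : pMetricType R) :
  measurable_fun [set: borel (X * X)%type]
    ((fun q => mdist q.1 q.2) : borel (X * X)%type -> R).
Proof.
exact: (@continuous_borel_real R (X * X)%type) (@continuous_mdist R X).
Qed.

Lemma measurable_mdistr (R : realType) (X : pMetricType R) (x0 : X) :
  measurable_fun [set: borel X] (mdist x0 : borel X -> R).
Proof.
apply: (@continuous_borel_real R X).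
apply: (@lipschitz1_continuous R X) => x y.
rewrite ler_norml.
have := metric_triangle x0 x y; have := metric_triangle x0 y x.
by rewrite (metric_sym y x) => *; apply/andP; split; lra.
Qed.

Lemma measurable_mdistl (R : realType) (X : pMetricType R) (x0 : X) :
  measurable_fun [set: borel X] ((fun x => mdist x x0) : borel X -> R).
Proof.
rewrite (_ : (fun x => _) = mdist x0); first exact: measurable_mdistr.
by apply/funext => x; exact: metric_sym.
Qed.

Lemma measurable_preimage_ball d (S : measurableType d) (R : realType)
    (X : metricType R) (f : S -> X) (x : X) (e : R) :
    measurable_fun [set: S] (fun s => mdist x (f s)) ->
  measurable (f @^-1` ball x e).
Proof.
move=> mf; have := mf measurableT _ (measurable_itv `]-oo, e[).
rewrite setTI; congr (measurable _); apply/seteqP.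
by split=> s /=; rewrite ballEmdist/= in_itv.
Qed.

(** Measurability of a map into a separable metric space is a matter of
    real-valued functions only: the preimage of a ball is a sublevel set of
    a distance function. *)
Lemma measurable_borel_mdist d (S : measurableType d) (R : realType)
    (X : pMetricType R) (I : countType) (D : I -> X) (f : S -> X) :
    ball_dense D ->
    (forall x, measurable_fun [set: S] (fun s => mdist x (f s))) ->
  measurable_fun [set: S] (f : S -> borel X).
Proof.
move=> denseD mf; apply: measurable_borel_ball denseD _ => i e.
exact: measurable_preimage_ball.
Qed.

(** Separability is essential here: it makes the Borel sets of the product
    the product of the Borel sets. *)
Lemma measurable_borel_pair d (S : measurableType d) (R : realType)
    (X Y : pMetricType R) (I J : countType) (D : I -> X) (E : J -> Y)
    (f : S -> X) (g : S -> Y) :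
    ball_dense D -> ball_dense E ->
    (forall x, measurable_fun [set: S] (fun s => mdist x (f s))) ->
    (forall y, measurable_fun [set: S] (fun s => mdist y (g s))) ->
  measurable_fun [set: S] ((fun s => (f s, g s)) : S -> borel (X * Y)%type).
Proof.
move=> denseD denseE mf mg.
apply: (@measurable_borel_ball _ S R (X * Y)%type (I * J)%type
  (fun ij => (D ij.1, E ij.2))) => [[x y] e e0|[i j] e].
  have [[i xi] [j yj]] := (denseD x e e0, denseE y e e0).
  by exists (i, j).
rewrite (_ : _ @^-1` _ = f @^-1` ball (D i) e `&` g @^-1` ball (E j) e)//.
by apply: measurableI; exact: measurable_preimage_ball.
Qed.

(** * Finite moments and transport costs *)

Lemma measurable_cost d (S : measurableType d) (R : realType) (p : R)
    (k : S -> R) :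
  measurable_fun [set: S] k -> measurable_fun [set: S] (fun s => (k s `^ p)%:E).
Proof.
move=> mk; apply/measurable_EFinP.
exact: (measurableT_comp (measurable_powR p) mk).
Qed.

(** Being at finite [L^p] distance is transitive: from
    [d f h <= 2 max (d f g) (d g h)] one gets the pointwise bound
    [d f h ^ p <= 2 ^ p (d f g ^ p + d g h ^ p)]. *)
Lemma lty_integral_mdist_triangle d (S : measurableType d) (R : realType)
    (P : {measure set S -> \bar R}) (X : metricType R) (p : R)
    (f g h : S -> X) :
    0 <= p ->
    measurable_fun setT (fun s => mdist (f s) (g s)) ->
    measurable_fun setT (fun s => mdist (g s) (h s)) ->
    measurable_fun setT (fun s => mdist (f s) (h s)) ->
  (\int[P]_s (mdist (f s) (g s) `^ p)%:E < +oo)%E ->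
  (\int[P]_s (mdist (g s) (h s) `^ p)%:E < +oo)%E ->
  (\int[P]_s (mdist (f s) (h s) `^ p)%:E < +oo)%E.
Proof.
move=> p0 mfg mgh mfh ifg igh.
have mp := @measurable_cost _ S R p.
apply: (@le_lt_trans _ _
  (\int[P]_s ((2 `^ p)%:E * ((mdist (f s) (g s) `^ p)%:E +
                            (mdist (g s) (h s) `^ p)%:E)))%E).
- apply: ge0_le_integral => //.
  + by move=> s _; rewrite lee_fin powR_ge0.
  + exact: mp.
  + by apply: measurable_funeM; apply: emeasurable_funD; exact: mp.
  + move=> s _; rewrite -EFinD -EFinM lee_fin.
    set a := mdist (f s) (g s); set b := mdist (g s) (h s).
    have a0 : 0 <= a by exact: mdist_ge0.
    have b0 : 0 <= b by exact: mdist_ge0.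
    have ab : mdist (f s) (h s) <= 2 * Num.max a b.
      apply: le_trans (metric_triangle _ (g s) _) _.
      by rewrite -/a -/b maxEle; case: (leP a b); lra.
    have m0 : 0 <= Num.max a b by rewrite le_max a0.
    apply: le_trans (ge0_ler_powR p0 _ _ ab) _; rewrite ?nnegrE ?mdist_ge0//.
      by rewrite mulr_ge0.
    rewrite powRM// ler_wpM2l ?powR_ge0// maxEle.
    by case: ifP => _; rewrite ?lerDl ?lerDr powR_ge0.
- rewrite ge0_integralZl//=.
  + rewrite ge0_integralD//; try exact: mp.
    * by apply: lte_mul_pinfty; rewrite ?lee_fin ?powR_ge0// lte_add_pinfty.
    * by move=> s _; rewrite lee_fin powR_ge0.
    * by move=> s _; rewrite lee_fin powR_ge0.
  + by apply: emeasurable_funD; exact: mp.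
  + by move=> s _; rewrite adde_ge0// lee_fin powR_ge0.
Qed.

Lemma integral_pushforward_prob d d' (S : measurableType d)
    (T : measurableType d') (R : realType) (mu : probability S R) (f : S -> T)
    (mf : measurable_fun [set: S] f) (g : T -> \bar R) :
    measurable_fun [set: T] g -> (forall y, 0 <= g y)%E ->
  (\int[pushforward_prob mu mf]_y g y = \int[mu]_x g (f x))%E.
Proof. by move=> mg g0; rewrite ge0_integral_distribution. Qed.

Lemma integral_cst_prob_lty d (S : measurableType d) (R : realType)
    (P : probability S R) (c : R) :
  (\int[P]_s c%:E < +oo)%E.
Proof. by rewrite integral_cst//= probability_setT mule1 ltry. Qed.

Section wasserstein_lemmas.
Context {R : realType} {X : pMetricType R} (p : R) (p0 : 0 <= p).
Local Open Scope ereal_scope.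

Lemma wasserstein_space_basepoint (mu : probability (borel X) R) (x0 : X) :
  wasserstein_space p mu -> \int[mu]_x (mdist (x : X) x0 `^ p)%:E < +oo.
Proof.
move=> [x1 mu1].
have mcst : measurable_fun [set: borel X]
  (fun=> mdist x1 x0 : measurableTypeR R) by [].
apply: (@lty_integral_mdist_triangle _ (borel X) R mu X p
  id (cst x1) (cst x0) p0
  (measurable_mdistl x1) mcst (measurable_mdistl x0) mu1).
exact: (integral_cst_prob_lty mu (mdist x1 x0 `^ p)).
Qed.

Lemma transport_cost_map (mu : probability (borel X) R) (T : X -> X)
    (mIdT : measurable_fun [set: borel X]
       ((fun q => (q, T q)) : borel X -> borel (X * X)%type)) :
  transport_cost p (pushforward_prob mu mIdT) =
  \int[mu]_q (mdist (q : X) (T q) `^ p)%:E.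
Proof.
rewrite /transport_cost integral_pushforward_prob//.
- exact: (measurable_cost p (@measurable_mdist R X)).
- by move=> y; rewrite lee_fin powR_ge0.
Qed.

(** Both directions are instances of [lty_integral_mdist_triangle], applied to
    [q], [T q] and a base point: the three pairwise distances have finite
    [p]-th moments as soon as two of them do. *)
Lemma wasserstein_space_pushforward (mu : probability (borel X) R) (T : X -> X)
    (mT : measurable_fun [set: borel X] (T : borel X -> borel X))
    (mIdT : measurable_fun [set: borel X]
       ((fun q => (q, T q)) : borel X -> borel (X * X)%type)) :
  wasserstein_space p mu ->
  wasserstein_space p (pushforward_prob mu mT) <->
  transport_cost p (pushforward_prob mu mIdT) < +oo.
Proof.
move=> Wmu; rewrite transport_cost_map.
have mcost : measurable_fun setT ((fun q : X => mdist q (T q)) : borel X -> R).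
  exact: (measurableT_comp (@measurable_mdist R X) mIdT).
have mTl x0 :
    measurable_fun setT ((fun q : X => mdist (T q) x0) : borel X -> R).
  exact: (measurableT_comp (@measurable_mdistl R X x0) mT).
have mTr x0 :
    measurable_fun setT ((fun q : X => mdist x0 (T q)) : borel X -> R).
  exact: (measurableT_comp (@measurable_mdistr R X x0) mT).
have WTE x0 : \int[pushforward_prob mu mT]_x (mdist (x : X) x0 `^ p)%:E =
    \int[mu]_x (mdist (T x) x0 `^ p)%:E.
  rewrite integral_pushforward_prob//.
  - exact: (measurable_cost p (@measurable_mdistl R X x0)).
  - by move=> y; rewrite lee_fin powR_ge0.
have symE (f g : X -> X) : \int[mu]_x (mdist (f x) (g x) `^ p)%:E =
    \int[mu]_x (mdist (g x) (f x) `^ p)%:E.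
  by apply: eq_integral => x _; rewrite metric_sym.
split=> [[x0]|cost_fin].
- rewrite WTE (symE T (cst x0)).
  apply: (@lty_integral_mdist_triangle _ (borel X) R mu X p id (cst x0) T p0
    (measurable_mdistl x0) (mTr x0) mcost).
  exact: wasserstein_space_basepoint.
- exists point; rewrite WTE.
  have mcost' :
      measurable_fun setT ((fun q : X => mdist (T q) q) : borel X -> R).
    rewrite (_ : (fun q => _) = (fun q : X => mdist q (T q)))//.
    by apply/funext => q; exact: metric_sym.
  apply: (@lty_integral_mdist_triangle _ (borel X) R mu X p T id (cst point) p0
    mcost' (measurable_mdistl point) (mTl point)).
    by rewrite (symE T id).
  exact: wasserstein_space_basepoint.
Qed.

End wasserstein_lemmas.

(** * Geometry and Borel structure of the Heisenberg group *)

Section heisenberg.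
Context {R : realType} {n : nat}.
Implicit Types (q : heis R n) (u v : euclid R n).

(** The subtracted term is the height of the lift of [q] over the projection
    of [q']: the distance measures the vertical gap to that horizontal lift. *)
Lemma heis_distE q q' : heis_dist q q' =
  ((\sum_(i < n) ((q'.1.1 0 i - q.1.1 0 i) ^+ 2 +
                  (q'.1.2 0 i - q.1.2 0 i) ^+ 2)) ^+ 2 +
   (q'.2 - (q.2 + 2 * (dotv q.1.2 q'.1.1 - dotv q.1.1 q'.1.2))) ^+ 2) `^ 4^-1.
Proof.
case: q q' => [[x y] z] [[x' y'] z']; rewrite /heis_dist /=.
congr (((_ ^+ 2) + (_ ^+ 2)) `^ _).
  by apply: eq_bigr => i _; rewrite !mxE; ring.
rewrite /dotv -sumrB opprD -mulrN -sumrN addrA (addrC z'); congr (_ + 2 * _).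
by apply: eq_bigr => i _; rewrite !mxE; ring.
Qed.

Lemma heis_dist_pow4 q q' : heis_dist q q' ^+ 4 =
  (\sum_(i < n) ((q'.1.1 0 i - q.1.1 0 i) ^+ 2 +
                  (q'.1.2 0 i - q.1.2 0 i) ^+ 2)) ^+ 2 +
   (q'.2 - (q.2 + 2 * (dotv q.1.2 q'.1.1 - dotv q.1.1 q'.1.2))) ^+ 2.
Proof.
rewrite heis_distE -powR_mulrn ?powR_ge0// -powRrM mulVf// powRr1//.
by rewrite addr_ge0// sqr_ge0.
Qed.

Lemma heis_dist_lift (T : euclid R n -> euclid R n) q :
  heis_dist q (heis_lift T q) = euclid_dist (heis_proj q) (T (heis_proj q)).
Proof.
case: q => [[x y] z]; rewrite heis_distE /heis_lift/= subrr expr0n/= addr0.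
set S := \sum_i _.
have S0 : 0 <= S by apply: sumr_ge0 => i _; rewrite addr_ge0// sqr_ge0.
rewrite -powR_mulrn// -powRrM (_ : 2%:R * 4^-1 = 2^-1); last by field.
rewrite powR12_sqrt//; congr Num.sqrt; apply: eq_bigr => i _ /=; ring.
Qed.

Lemma heis_proj_lift (T : euclid R n -> euclid R n) q :
  heis_proj (heis_lift T q) = T (heis_proj q).
Proof. by case: q => [[x y] z]; rewrite /heis_proj/=; case: (T (x, y)). Qed.

Lemma rat_row_approx (v : 'rV[R]_n) (d : R) : 0 < d ->
  exists w : 'rV[rat]_n, forall i, (map_mx ratr w 0 i - v 0 i) ^+ 2 < d ^+ 2.
Proof.
move=> d0; have [f fv] : exists f : 'I_n -> rat,
    forall i, (ratr (f i) - v 0 i) ^+ 2 < d ^+ 2.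
  apply: (@fin_all_exists _ (fun=> rat)
    (fun i r => (ratr r - v 0 i) ^+ 2 < d ^+ 2)) => i.
  have /rat_in_itvoo[r] : v 0 i - d < v 0 i + d by lra.
  rewrite in_itv/= => /andP[r1 r2]; exists r.
  rewrite -subr_gt0 (_ : _ - _ = (ratr r - (v 0 i - d)) * (v 0 i + d - ratr r)).
    by rewrite mulr_gt0// subr_gt0.
  by ring.
by exists (\row_i f i) => i; rewrite !mxE.
Qed.

Definition rat_heis (t : 'rV[rat]_n * 'rV[rat]_n * rat) : heis R n :=
  (map_mx ratr t.1.1, map_mx ratr t.1.2, ratr t.2).

(** The horizontal coordinates are approximated first; the rational height is
    then chosen close to the height [c] of the lift of [q] over them rather than
    to that of [q], so that no estimate of the twisting term is needed. *)
Lemma dense_rat_heis : ball_dense rat_heis.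
Proof.
move=> q e e0; rewrite ballEmdist/=.
(* The fourth power of the distance will be at most                           *)
(* (2 n d ^ 2) ^ 2 + d ^ 2 <= ((2 n + 1) d) ^ 2 when d <= 1.                  *)
pose N : R := n%:R * 2 + 1.
have N1 : 1 <= N by rewrite lerDr mulr_ge0.
pose d : R := Num.min 1 (e ^+ 2 / N).
have d0 : 0 < d.
  by rewrite lt_min ltr01 divr_gt0 ?exprn_gt0// (lt_le_trans _ N1).
have d1 : d <= 1 by rewrite ge_min lexx.
have dN : d * N <= e ^+ 2.
  rewrite -ler_pdivlMr ?(lt_le_trans _ N1)//.
  by rewrite ge_min lexx orbT.
have [x' xx'] := rat_row_approx q.1.1 d0.
have [y' yy'] := rat_row_approx q.1.2 d0.
pose c := q.2 + 2 * (dotv q.1.2 (map_mx ratr x') - dotv q.1.1 (map_mx ratr y')).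
have /rat_in_itvoo[z'] : c - d < c + d by lra.
rewrite in_itv/= => /andP[z1 z2].
exists (x', y', z'); rewrite -(@ltr_pXn2r _ 4) ?nnegrE ?mdist_ge0 ?(ltW e0)//.
change (heis_dist q (rat_heis (x', y', z')) ^+ 4 < e ^+ 4).
rewrite heis_dist_pow4 /rat_heis/= -/c; set S := \sum_i _.
have S0 : 0 <= S by apply: sumr_ge0 => i _; rewrite addr_ge0// sqr_ge0.
have Sd : S <= (n%:R * 2) * d.
  apply: (@le_trans _ _ (\sum_(i < n) (d + d))).
    have dd : d ^+ 2 <= d by rewrite expr2 ger_pMl.
    apply: ler_sum => i _; apply: lerD; apply: le_trans dd; exact: ltW.
  by rewrite sumr_const card_ord -mulr_natl; lra.
have cd : (ratr z' - c) ^+ 2 < d ^+ 2.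
  rewrite -subr_gt0 (_ : _ - _ = (ratr z' - (c - d)) * (c + d - ratr z')).
    by rewrite mulr_gt0// subr_gt0.
  by ring.
have S2 : S ^+ 2 <= ((n%:R * 2) * d) ^+ 2.
  by rewrite ler_sqr ?nnegrE ?(le_trans S0).
apply: (@lt_le_trans _ _ ((d * N) ^+ 2)); last first.
  rewrite (_ : e ^+ 4 = (e ^+ 2) ^+ 2); last by rewrite -exprM.
  by rewrite ler_sqr ?nnegrE ?sqr_ge0// mulr_ge0 ?(ltW d0)// (le_trans _ N1).
rewrite /N; set m : R := n%:R.
have m0 : 0 <= m * d ^+ 2 by rewrite mulr_ge0 ?ler0n ?sqr_ge0.
apply: (@lt_le_trans _ _ ((m * 2 * d) ^+ 2 + d ^+ 2)); first exact: ler_ltD.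
rewrite -subr_ge0 (_ : _ - _ = 4 * (m * d ^+ 2)); first by rewrite mulr_ge0.
by ring.
Qed.

Lemma euclid_coord_le u v i :
  `|u.1 0 i - v.1 0 i| <= euclid_dist u v /\
  `|u.2 0 i - v.2 0 i| <= euclid_dist u v.
Proof.
have le_dist a :
    a ^+ 2 <= (u.1 0 i - v.1 0 i) ^+ 2 + (u.2 0 i - v.2 0 i) ^+ 2 ->
    `|a| <= euclid_dist u v.
  move=> ale; rewrite -sqrtr_sqr ler_wsqrtr// (le_trans ale)//.
  rewrite (bigD1 i)//= lerDl sumr_ge0// => j _.
  by rewrite addr_ge0// sqr_ge0.
by split; apply: le_dist; rewrite ?lerDl ?lerDr sqr_ge0.
Qed.

Lemma measurable_euclid_fst i :
  measurable_fun setT ((fun u => u.1 0 i) : borel (euclid R n) -> R).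
Proof.
apply: (@continuous_borel_real R (euclid R n)).
apply: (@lipschitz1_continuous R (euclid R n)) => u v.
exact: (euclid_coord_le u v i).1.
Qed.

Lemma measurable_euclid_snd i :
  measurable_fun setT ((fun u => u.2 0 i) : borel (euclid R n) -> R).
Proof.
apply: (@continuous_borel_real R (euclid R n)).
apply: (@lipschitz1_continuous R (euclid R n)) => u v.
exact: (euclid_coord_le u v i).2.
Qed.

(** In the distance from [q] to a point of the centre of the group, the twisting
    term vanishes and the horizontal part is the same for all such points, so
    [d (q, (0, 0, 1)) ^ 4 - d (q, 0) ^ 4 = (1 - z) ^ 2 - z ^ 2 = 1 - 2 z]:
    the height is a polynomial in distance functions. *)
Lemma measurable_heis_height :
  measurable_fun setT ((fun q => q.2) : borel (heis R n) -> R).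
Proof.
have -> : (fun q => q.2) = (fun q =>
    2^-1 * (1 - (mdist q ((0, 0, 1) : heis R n) ^+ 4 -
                 mdist q ((0, 0, 0) : heis R n) ^+ 4))).
  apply/funext => q; rewrite !heis_mdistE !heis_dist_pow4/=.
  have dot0 (w : 'rV[R]_n) : dotv w 0 = 0.
    by rewrite /dotv big1// => i _; rewrite mxE mulr0.
  by rewrite !dot0; field.
apply: measurable_funM => //; apply: measurable_funB => //.
by apply: measurable_funB; apply: measurable_funX; exact: measurable_mdistl.
Qed.

Lemma measurable_dotv d (S : measurableType d) (f g : S -> 'rV[R]_n) :
  (forall i, measurable_fun setT (fun s => f s 0 i)) ->
  (forall i, measurable_fun setT (fun s => g s 0 i)) ->
  measurable_fun setT (fun s => dotv (f s) (g s)).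
Proof. by move=> mf mg; apply: measurable_sum => i; exact: measurable_funM. Qed.

Lemma measurable_heis_dist d (S : measurableType d) (f : S -> heis R n) :
  (forall i, measurable_fun setT (fun s => (f s).1.1 0 i)) ->
  (forall i, measurable_fun setT (fun s => (f s).1.2 0 i)) ->
  measurable_fun setT (fun s => (f s).2) ->
  forall q, measurable_fun setT (fun s => mdist q (f s)).
Proof.
move=> mx my mz q.
under eq_fun do rewrite heis_mdistE heis_distE.
apply: (measurableT_comp (measurable_powR _)).
apply: measurable_funD; apply: measurable_funX.
  apply: measurable_sum => i.
  by apply: measurable_funD; apply: measurable_funX; apply: measurable_funB.
apply: measurable_funB => //; apply: measurable_funD => //.
apply: measurable_funM => //.
by apply: measurable_funB; apply: measurable_dotv.
Qed.

Lemma measurable_heis_lift_dist (T : euclid R n -> euclid R n) :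
  measurable_fun setT (T : borel (euclid R n) -> borel (euclid R n)) ->
  forall q, measurable_fun setT
    ((fun q' => mdist q (heis_lift T q')) : borel (heis R n) -> R).
Proof.
move=> mT.
have mpi := @measurable_heis_proj R n.
have mTpi := measurableT_comp mT mpi.
have mTx i : measurable_fun setT
    ((fun q => (T (heis_proj q)).1 0 i) : borel (heis R n) -> R).
  exact: (measurableT_comp (measurable_euclid_fst i) mTpi).
have mTy i : measurable_fun setT
    ((fun q => (T (heis_proj q)).2 0 i) : borel (heis R n) -> R).
  exact: (measurableT_comp (measurable_euclid_snd i) mTpi).
have liftE q : heis_lift T q = ((T (heis_proj q)).1, (T (heis_proj q)).2,
    q.2 + 2 * (dotv (heis_proj q).2 (T (heis_proj q)).1 -
               dotv (heis_proj q).1 (T (heis_proj q)).2)).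
  by case: q => [[x y] z].
apply: (@measurable_heis_dist _ (borel (heis R n))).
- by move=> i; under eq_fun do rewrite liftE; exact: mTx.
- by move=> i; under eq_fun do rewrite liftE; exact: mTy.
- under eq_fun do rewrite liftE/=.
  apply: measurable_funD; first exact: measurable_heis_height.
  apply: measurable_funM => //; apply: measurable_funB.
    apply: measurable_dotv => // i.
    exact: (measurableT_comp (measurable_euclid_snd i) mpi).
  apply: measurable_dotv => // i.
  exact: (measurableT_comp (measurable_euclid_fst i) mpi).
Qed.

End heisenberg.

(** * Lifting optimal transport maps along short maps *)

Section short_projection.
Context {R : realType} {X Y : pMetricType R} (f : X -> Y).
Context (short_f : forall x x', mdist (f x) (f x') <= mdist x x').

Lemma short_continuous2 :
  continuous (fun q : X * X => (f q.1, f q.2) : Y * Y).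
Proof.
move=> [x x']; apply/cvg_ballP => e e0.
apply: filterS (nbhsx_ballx (x, x') _ e0) => -[y y'] [].
by rewrite !ballEmdist /ball/= /prod_ball !ballEmdist /= => xy xy';
  split; exact: le_lt_trans (short_f _ _) _.
Qed.

Lemma measurable_short2 :
  measurable_fun [set: borel (X * X)%type]
    ((fun q => (f q.1, f q.2)) : borel (X * X)%type -> borel (Y * Y)%type).
Proof. exact: (continuous_borel short_continuous2). Qed.

Lemma transport_cost_short (p : R) (Pi : probability (borel (X * X)%type) R) :
  0 <= p ->
  (transport_cost p (pushforward_prob Pi measurable_short2) <=
   transport_cost p Pi)%E.
Proof.
move=> p0; rewrite /transport_cost integral_pushforward_prob; first last.
- by move=> y; rewrite lee_fin powR_ge0.
- exact: (measurable_cost p (@measurable_mdist R Y)).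
apply: ge0_le_integral => //.
- by move=> q _; rewrite lee_fin powR_ge0.
- exact: (measurable_cost p
    (measurableT_comp (@measurable_mdist R Y) measurable_short2)).
- exact: (measurable_cost p (@measurable_mdist R X)).
- move=> q _; rewrite lee_fin; apply: ge0_ler_powR => //.
  + by rewrite nnegrE mdist_ge0.
  + by rewrite nnegrE mdist_ge0.
  + exact: short_f.
Qed.

Lemma wasserstein_space_short (p : R) (nu : probability (borel X) R)
    (mf : measurable_fun [set: borel X] (f : borel X -> borel Y)) :
  0 <= p -> wasserstein_space p nu ->
  wasserstein_space p (pushforward_prob nu mf).
Proof.
move=> p0 [x0 nu_fin]; exists (f x0); apply: le_lt_trans nu_fin.
rewrite integral_pushforward_prob; first last.
- by move=> y; rewrite lee_fin powR_ge0.
- exact: (measurable_cost p (@measurable_mdistl R Y (f x0))).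
apply: ge0_le_integral => //.
- by move=> q _; rewrite lee_fin powR_ge0.
- exact: (measurable_cost p
    (measurableT_comp (@measurable_mdistl R Y (f x0)) mf)).
- exact: (measurable_cost p (@measurable_mdistl R X x0)).
- move=> q _; rewrite lee_fin; apply: ge0_ler_powR => //.
  + by rewrite nnegrE mdist_ge0.
  + by rewrite nnegrE mdist_ge0.
Qed.

(** [f] projects the couplings competing with [L] to couplings competing with
    [T], which bounds their cost from below by the cost of [T]; as [L] and [T]
    displace corresponding points by the same distance, this is also the cost
    of [L]. *)
Lemma optimal_transport_map_lift (p : R) (nu : probability (borel X) R)
    (mf : measurable_fun [set: borel X] (f : borel X -> borel Y))
    (T : Y -> Y) (L : X -> X)
    (mL : measurable_fun [set: borel X] (L : borel X -> borel X))
    (mIdL : measurable_fun [set: borel X]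
       ((fun q => (q, L q)) : borel X -> borel (X * X)%type)) :
  0 <= p ->
  (forall q, f (L q) = T (f q)) ->
  (forall q, mdist q (L q) = mdist (f q) (T (f q))) ->
  wasserstein_space p nu ->
  optimal_transport_map p (pushforward_prob nu mf) T ->
  optimal_transport_map p nu L.
Proof.
move=> p0 fL dL Wnu [mT [mIdT [WT [_ optT]]]].
have costE : transport_cost p (pushforward_prob nu mIdL) =
    transport_cost p (pushforward_prob (pushforward_prob nu mf) mIdT).
  rewrite !transport_cost_map (integral_pushforward_prob nu mf).
  - by apply: eq_integral => q _; rewrite dL.
  - exact: (measurable_cost p (measurableT_comp (@measurable_mdist R Y) mIdT)).
  - by move=> y; rewrite lee_fin powR_ge0.
have Wmu := wasserstein_space_short mf p0 Wnu.
have L_coupling :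
    couplings nu (pushforward_prob nu mL) (pushforward_prob nu mIdL) by [].
exists mL, mIdL; split.
  rewrite (wasserstein_space_pushforward p0 mL mIdL Wnu) costE.
  by rewrite -(wasserstein_space_pushforward p0 mT mIdT Wmu).
split=> //; apply/eqP; rewrite eq_le; apply/andP; split; last first.
  by apply: ereal_inf_lbound; exists (pushforward_prob nu mIdL).
apply: le_ereal_inf_tmp => _ [Pi Pi_coupling <-].
rewrite costE optT; apply: le_trans (transport_cost_short Pi p0).
apply: ereal_inf_lbound; exists (pushforward_prob Pi measurable_short2) => //.
move=> A mA.
have mfA : measurable (f @^-1` A : set (borel X)).
  by have := mf measurableT A mA; rewrite setTI.
have [Pi1 Pi2] := Pi_coupling _ mfA; split; first exact: Pi1.
transitivity (nu (L @^-1` (f @^-1` A))); first exact: Pi2.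
rewrite /pushforward_prob /distribution /pushforward/=; congr (nu _).
by apply/funext => q /=; rewrite fL.
Qed.

End short_projection.

Theorem lemma3p2 (R : realType) (n : nat) (p : R)
    (hn : (1 <= n)%N) (hp : 1 <= p)
    (nu : probability (borel (heis R n)) R)
    (hnu : wasserstein_space p nu) :
  let mu := pushforward_prob nu (@measurable_heis_proj R n) in
  wasserstein_space p mu /\
  forall T : euclid R n -> euclid R n,
    optimal_transport_map p mu T ->
    optimal_transport_map p nu (heis_lift T).
Proof.
move=> mu; have p0 : 0 <= p by apply: le_trans hp.
have short_proj (q q' : heis R n) :
    mdist (heis_proj q) (heis_proj q') <= mdist q q'.
  exact: euclid_dist_proj.
split; first exact: wasserstein_space_short.
move=> T optT; have [mT _] := optT.
have mdL := measurable_heis_lift_dist mT.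
have mL := measurable_borel_mdist (@dense_rat_heis R n) mdL.
have mIdL := measurable_borel_pair (@dense_rat_heis R n)
  (@dense_rat_heis R n) (@measurable_mdistr R (heis R n)) mdL.
apply: (optimal_transport_map_lift short_proj mL mIdL p0 _ _ hnu optT) => q.
  exact: heis_proj_lift.
exact: heis_dist_lift.
Qed.
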